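(* Let $X$ be a metrizable topological vector space over $\mathbb{K}=\mathbb{R}$ or $\mathbb{C}$ and let $\mathcal{X}=(x_{n,k})_{n\geq k\geq 0}$ be a family of elements of $X$ such that $(x_{n,k})_{n\geq k}$ converges in $X$ for every $k\geq 0$. For $l\geq 1$ let $T_l$ be the set of all $b\in X$ for which there exist $(n,m)\in\mathbb{N}^2$ with $n>m\geq l$ and scalars $b_l,b_{l+1},\dots,b_m,\dots,b_n,b_{n+1},\dots\in\mathbb{K}$ such that $$b=\sum_{j=l}^m b_j x_{m,j}\quad\text{and, for every }k\geq n,\quad \sum_{j=l}^m b_j x_{k,j}=\sum_{j=m+1}^k b_j x_{k,j}.$$ If for every $l\geq 1$ the set $T_l$ is dense in $X$, then $\mathcal{U}(\mathcal{X})\cap\mathbb{K}^{\mathbb{N}}$ is spaceable.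
   Context: $\mathbb{K}^{\mathbb{N}}$ carries the Cartesian (product) topology. $\mathcal{U}(\mathcal{X})\cap\mathbb{K}^{\mathbb{N}}$ is the set of sequences $a=(a_k)_{k\geq 0}\in\mathbb{K}^{\mathbb{N}}$ such that $\left\{\sum_{k=0}^n a_k x_{n,k}:\ n\geq 0\right\}$ is dense in $X$. A subset of $\mathbb{K}^{\mathbb{N}}$ is spaceable if it contains, apart from $0$, a closed infinite-dimensional subspace of $\mathbb{K}^{\mathbb{N}}$. *)

(* Defs.v *)
From HB Require Import structures.
From mathcomp Require Import all_boot all_order all_algebra.
From mathcomp Require Export complex.
From mathcomp Require Import all_classical all_reals all_analysis.

Set Implicit Arguments.
Unset Strict Implicit.
Unset Printing Implicit Defensive.

Import Order.TTheory GRing.Theory Num.Theory.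
Import numFieldNormedType.Exports.

Local Open Scope classical_set_scope.
Local Open Scope ring_scope.

(* The distance is only required to induce the topology; in particular it need
   not be translation invariant when T is a topological vector space. *)
Definition metrizable (R : realType) (T : topologicalType) : Prop :=
  exists d : T -> T -> R,
    [/\ forall x y, 0 <= d x y,
        forall x y, d x y = 0 <-> x = y,
        forall x y, d x y = d y x,
        forall x y z, d x z <= d x y + d y z &
        forall (x : T) (A : set T),
          nbhs x A <-> exists2 e : R, 0 < e & [set y | d x y < e] `<=` A].

Definition finite_dimensional (K : fieldType) (E : lmodType K) (V : set E)
    : Prop :=
  exists (n : nat) (e : 'I_n -> E), (forall i, V (e i)) /\
    forall v, V v -> exists c : 'I_n -> K, v = \sum_(i < n) c i *: e i.

(* The vector space K^N is the function space nat -> K^o (K^o being K seen as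
   a module over itself); closedness is in the product topology. *)
Definition spaceable (K : numFieldType) (U : set (nat -> K^o)) : Prop :=
  exists V : set (nat -> K^o),
    [/\ GRing.submod_closed [in V],
        closed (V : set {ptws nat -> K^o}),
        ~ finite_dimensional V &
        V `\ (0 : nat -> K^o) `<=` U].

(* A triangular family (x_{n,k})_{n >= k >= 0} is a total function x, with
   x n k standing for x_{n,k}; in the definitions below only the values x n k
   with k <= n are used. *)

Definition universal_sequences (K : numFieldType) (X : topologicalLmodType K)
    (x : nat -> nat -> X) : set (nat -> K^o) :=
  [set a | dense (range (fun n : nat => \sum_(0 <= k < n.+1) a k *: x n k))].

(* Only the values of the sequence c at indices j >= l are used. *)
Definition T_set (K : numFieldType) (X : topologicalLmodType K)
    (x : nat -> nat -> X) (l : nat) : set X :=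
  [set b | exists n m : nat, [/\ (m < n)%N, (l <= m)%N &
     exists c : nat -> K,
       b = \sum_(l <= j < m.+1) c j *: x m j /\
       forall k : nat, (n <= k)%N ->
         \sum_(l <= j < m.+1) c j *: x k j =
         \sum_(m.+1 <= j < k.+1) c j *: x k j]].

(* Main.v *)
(** Density of T_l yields, in any nonempty open set O, a "block": a sequence c
    vanishing up to l whose partial sum sum_(k <= m) c_k x_{m,k} lies in O for
    some m > l, and whose partial sums sum_(k <= j) c_k x_{j,k} are exactly 0
    for all j >= n > m (take c_k = b_k for k <= m and -b_k for k > m; the tail
    is infinite).  Start each block after the previous one has cancelled: at
    the index m_s of the s-th block all other blocks contribute 0.  Label block
    s by a pair (i_s, t_s), aiming at the t_s-th member of a countable family
    of nonempty open sets such that every nonempty open set contains one of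
    them.  Then sum_s alpha_(i_s) c^s is universal as soon as some alpha_i is
    nonzero.  These sums form the required subspace: as the blocks have
    strictly increasing leading positions, the coefficients depend continuously
    on the sequence, so the subspace is closed. *)
Require Import Defs.
From mathcomp Require Import all_boot all_order all_algebra.
From mathcomp Require Import all_classical all_reals all_analysis.
From mathcomp Require Import lra.

Set Implicit Arguments.
Unset Strict Implicit.
Unset Printing Implicit Defensive.

Import Order.TTheory GRing.Theory Num.Theory.
Import numFieldNormedType.Exports.

Local Open Scope classical_set_scope.
Local Open Scope ring_scope.

(** * Triangular combinations of scalar sequences *)

(* The infinite sum of the beta_s c^s, when c is triangular: c s k = 0 for
   k < s. *)
Definition comb (K : numFieldType) (c : nat -> nat -> K) (beta : nat -> K) :
    nat -> K^o :=
  fun k => \sum_(0 <= s < k.+1) beta s * c s k.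

(** Forward substitution: at position [p s] only the blocks [t <= s] contribute, and [c s (p s)] is
    invertible. Each coefficient is thus a finite combination of coordinates, hence continuous. *)
Lemma comb_coef (K : numFieldType) (c : nat -> nat -> K) (p : nat -> nat) :
    (forall s, c s (p s) != 0) ->
    (forall s t, (s < t)%N -> c t (p s) = 0) ->
    (forall s, (s <= p s)%N) ->
  exists f : nat -> (nat -> K^o) -> K^o,
    (forall s, continuous (f s : {ptws nat -> K^o} -> K^o)) /\
    (forall s beta, f s (comb c beta) = beta s).
Proof.
move=> c_neq0 c_tri le_p.
suff H s : exists f : (nat -> K^o) -> K^o,
    continuous (f : {ptws nat -> K^o} -> K^o) /\
    (forall beta, f (comb c beta) = beta s).
  by have [f fP] := choice H; exists f; split=> s; have [] := fP s.
elim/ltn_ind: s => s IH.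
(* Made total in [t] for [choice]; the constant 0 is a dummy value for [t >= s]. *)
have {}IH t : exists f : (nat -> K^o) -> K^o,
    continuous (f : {ptws nat -> K^o} -> K^o) /\
    ((t < s)%N -> forall beta, f (comb c beta) = beta t).
  have [lt_ts|_] := ltnP t s.
    by have [f [f_cont fE]] := IH t lt_ts; exists f.
  exists (cst 0); split=> [|//].
  exact: (@cst_continuous {ptws nat -> K^o} K^o 0).
have [g gP] := choice IH.
exists (fun a => (a (p s) - \sum_(0 <= t < s) g t a * c t (p s)) / c s (p s)).
split=> [a|beta].
- apply: (@cvgM K _ (nbhs (a : {ptws nat -> K^o}))); last exact: cvg_cst.
  apply: (@cvgB _ _ _ (nbhs (a : {ptws nat -> K^o}))).
    exact: (@proj_continuous nat (fun=> K^o) (p s) a).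
  move: a; apply: (@continuous_big K^o) => [|t _ a].
    exact: (@tvs.add_continuous K^o).
  by apply: (@cvgM K _ (nbhs (a : {ptws nat -> K^o})));
    [exact: (gP t).1|exact: cvg_cst].
- have ->: comb c beta (p s) =
      \sum_(0 <= t < s) beta t * c t (p s) + beta s * c s (p s).
    rewrite /comb (big_cat_nat _ (n := s.+1)) //= ?ltnS ?le_p //.
    rewrite big_nat_recr //= -[RHS]addr0; congr (_ + _).
    rewrite big_nat_cond big1 // => t; rewrite andbT => /andP[lt_st _].
    by rewrite c_tri ?mulr0.
  have -> : \sum_(0 <= t < s) g t (comb c beta) * c t (p s) =
      \sum_(0 <= t < s) beta t * c t (p s).
    by apply: eq_big_nat => t /andP[_ lt_ts]; rewrite (gP t).2.
  by rewrite addrAC subrr add0r mulfK.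
Qed.


Lemma comb_linear (K : numFieldType) (c : nat -> nat -> K) (r : K)
    (beta gamma : nat -> K) :
  comb c (fun s => r * beta s + gamma s) = r *: comb c beta + comb c gamma.
Proof.
apply/funext => k; rewrite -[RHS]/(r * comb c beta k + comb c gamma k) /comb.
rewrite big_distrr -big_split /=; apply: eq_bigr => s _.
by rewrite mulrDl mulrA.
Qed.

Lemma comb_sum (K : numFieldType) (c : nat -> nat -> K) n (a : 'I_n -> K)
    (beta : 'I_n -> nat -> K) :
  \sum_(i < n) a i *: comb c (beta i) =
  comb c (fun s => \sum_(i < n) a i * beta i s).
Proof.
apply/funext => k; rewrite /comb fct_sumE.
under [RHS]eq_bigr => s _ do rewrite big_distrl.
rewrite exchange_big; apply: eq_bigr => i _.
rewrite -[LHS]/(a i * \sum_(0 <= s < k.+1) beta i s * c s k) big_distrr.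
by apply: eq_bigr => s _; rewrite /= mulrA.
Qed.

(** Writing [n.+1] of the [u i] in [n] generators gives a matrix with more rows than columns; a
    nonzero vector of its left kernel is a linear relation. *)
Lemma not_finite_dimensional (K : fieldType) (E : lmodType K) (V : set E)
    (u : nat -> E) :
    (forall i, V (u i)) ->
    (forall n (a : 'I_n -> K), \sum_(i < n) a i *: u i = 0 ->
      forall i, a i = 0) ->
  ~ finite_dimensional V.
Proof.
move=> Vu u_free [n [e [Ve V_span]]].
have [M MP] := choice (fun i => V_span (u i) (Vu i)).
pose A : 'M[K]_(n.+1, n) := \matrix_(i, j) M i j.
have /rowV0Pn[w /sub_kermxP wA w_neq0] : kermx A != 0.
  by rewrite kermx_eq0 /row_free ltn_eqF // ltnS rank_leq_col.
case/eqP: w_neq0; apply/rowP => i; rewrite mxE.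
apply: (u_free n.+1 (fun i => w 0 i)).
under eq_bigr => j _ do rewrite MP scaler_sumr.
rewrite exchange_big big1 //= => k _.
under eq_bigr => j _ do rewrite scalerA.
rewrite -scaler_suml.
have := congr1 (fun B : 'rV_n => B 0 k) wA; rewrite !mxE => wAk.
under eq_bigr => j _ do
  rewrite -[M j k](mxE matrix_key (fun i j : 'I__ => M i j)).
by rewrite wAk scale0r.
Qed.

(** * Continuity of the vector operations and countable dense families *)

Section Topology.
Variables (K : numFieldType) (X : topologicalLmodType K).

Lemma affine_continuous (w v : X) : continuous (fun t : K^o => w + t *: v).
Proof.
move=> t; apply: (continuous2_cvg (nbhs_filter _) (h := fun x y : X => x + y)).
- exact: (@add_continuous X (w, t *: v)).
- exact: cvg_cst.
apply: (continuous2_cvg (nbhs_filter _) (h := fun (x : K^o) (y : X) => x *: y)).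
- exact: (@scale_continuous K X (t, v)).
- exact: cvg_id.
exact: cvg_cst.
Qed.

Lemma scale_open (r : K) (U : set X) :
  r != 0 -> open U -> open [set v | U (r *: v)].
Proof.
move=> r_neq0; rewrite !openE => Uo v /Uo Urv.
apply: (continuous2_cvg (nbhs_filter _) (h := fun (x : K^o) (y : X) => x *: y));
  last exact: Urv.
- exact: (@scale_continuous K X (r, v)).
- exact: cvg_cst.
- exact: cvg_id.
Qed.

(** By continuity of [t *: v] at 0, some [t != 0] close to 0 satisfies [t *: v = 0]. *)
Lemma open_set1_trivial : open [set (0 : X)] -> forall v : X, v = 0.
Proof.
rewrite openE => /(_ 0 erefl) nbhs0 v.
have {}nbhs0 : nbhs (0 + 0 *: v) [set (0 : X)] by rewrite scale0r addr0.
have H := @affine_continuous 0 v 0 _ nbhs0.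
have /(@filter_ex _ (0 : K)^')[t [tv t_neq0]] :
    \forall t \near (0 : K)^', [set 0] (0 + t *: v) /\ t != 0.
  by apply: (@filterS _ (nbhs (0 : K)) _ _ _ _ H) => t tv t_neq0; split.
by move/eqP: tv; rewrite add0r scaler_eq0 (negbTE t_neq0) => /eqP.
Qed.

(** The coefficients are changed one at a time, [v] absorbing the terms set aside. The indices form
    a finite sequence, so that the choices are countable. *)
Lemma dense_combination (q : nat -> K) :
    (forall (z e : K), 0 < e -> exists n, `|z - q n| < e) ->
  forall (U : set X) (y : nat -> X) (c : nat -> K) n v, open U ->
    U (v + \sum_(0 <= j < n) c j *: y j) ->
  exists2 s : seq nat, size s = n &
    U (v + \sum_(0 <= j < n) q (nth 0%N s j) *: y j).
Proof.
move=> q_dense U y c n; elim: n => [|n IH] v Uo.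
  by rewrite big_geq // => Uv; exists [::]; rewrite ?big_geq.
rewrite big_nat_recr //= addrA [_ + _ *: _]addrAC => /(IH _ Uo)[s size_s].
rewrite addrAC; move: (Uo); rewrite openE => Unbhs /Unbhs.
move/affine_continuous => /nbhs_ballP[e /= e_gt0 Ue].
have [t ct] := q_dense (c n) e e_gt0.
exists (rcons s t); first by rewrite size_rcons size_s.
rewrite big_nat_recr //= nth_rcons size_s ltnn eqxx addrA.
rewrite (eq_big_nat _ _ (F2 := fun j => q (nth 0%N s j) *: y j)).
  exact: (Ue (q t) ct).
by move=> j /andP[_ lt_jn]; rewrite nth_rcons size_s lt_jn.
Qed.

End Topology.

(** Balls of radius 1/(r+1) around the points [d i], coded by pairs (i, r): a ball of radius [e]
    around [y] contains one with [d i] within [e / 2] of [y] and radius below [e / 2]. *)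
Lemma metrizable_pseudobase (R : realType) (T : topologicalType)
    (d : nat -> T) :
    metrizable R T -> dense (range d) ->
  exists O : nat -> set T, (forall t, open (O t) /\ O t !=set0) /\
    (forall U, open U -> U !=set0 -> exists t, O t `<=` U).
Proof.
move=> [rho [rho_ge0 rho0 rhoC rho_tri rho_nbhs]] d_dense.
pose B (a : T) (e : R) := [set y | rho a y < e].
have B_open a e : open (B a e).
  rewrite openE => y ay; apply/rho_nbhs; exists (e - rho a y).
    by rewrite subr_gt0.
  move=> z /= yz; apply: le_lt_trans (rho_tri a y z) _.
  by rewrite -ltrBrDl.
have B_self a e : 0 < e -> B a e a.
  by move=> e_gt0; rewrite /B /= (iffRL (rho0 a a)).
pose dec t : nat * nat := odflt (0, 0)%N (unpickle t).
exists (fun t => B (d (dec t).1) (dec t).2.+1%:R^-1); split.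
  move=> t; split=> //; exists (d (dec t).1).
  by apply: B_self; rewrite invr_gt0.
move=> U Uo [y Uy]; have := Uo; rewrite openE.
move=> /(_ y Uy) /rho_nbhs[e e_gt0 eU].
have [_ [/[swap] [[i _ <-]] ye]] : B y (e / 2) `&` range d !=set0.
  by apply: d_dense => //; exists y; apply: B_self; rewrite divr_gt0.
have e2_gt0 : 0 < e / 2 by rewrite divr_gt0.
have [r re] : exists r : nat, r.+1%:R^-1 < e / 2.
  exists (Num.truncn (e / 2)^-1); rewrite invf_plt ?posrE //.
  exact: truncnS_gt.
exists (pickle (i, r)); rewrite /dec pickleK /= => z iz; apply: eU => /=.
apply: le_lt_trans (rho_tri y (d i) z) _; rewrite [e]splitr.
by apply: ltrD => //; apply: lt_trans re.
Qed.

(** * Blocks and their successive choice *)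

Section Blocks.
Variables (K : numFieldType) (X : topologicalLmodType K) (x : nat -> nat -> X).

(** The position [p] of a nonzero entry is a pivot: a later block, starting at [n] or beyond,
    vanishes there. *)
Definition block (l : nat) (O : set X) (n m p : nat) (c : nat -> K) :=
  [/\ (l < m < n)%N, (l < p <= m)%N & c p != 0] /\
  [/\ forall j, (j <= l)%N -> c j = 0,
      O (\sum_(0 <= j < m.+1) c j *: x m j) &
      forall k, (n <= k)%N -> \sum_(0 <= j < k.+1) c j *: x k j = 0].

Lemma block_of_T_set (l n m p : nat) (O : set X) (c : nat -> K) :
    (m < n)%N -> (l < p <= m)%N -> c p != 0 ->
    O (\sum_(l.+1 <= j < m.+1) c j *: x m j) ->
    (forall k, (n <= k)%N -> \sum_(l.+1 <= j < m.+1) c j *: x k j =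
       \sum_(m.+1 <= j < k.+1) c j *: x k j) ->
  exists c', block l O n m p c'.
Proof.
move=> lt_mn /andP[lt_lp le_pm] cp Oc c_cancel.
have lt_lm : (l < m)%N by exact: leq_trans le_pm.
pose c' j := if (j <= l)%N then 0 else if (j <= m)%N then c j else - c j.
have head k : \sum_(0 <= j < m.+1) c' j *: x k j =
    \sum_(l.+1 <= j < m.+1) c j *: x k j.
  rewrite (big_cat_nat _ (n := l.+1)) //=; last by rewrite ltnS ltnW.
  rewrite big_nat_cond big1 ?add0r.
    apply: eq_big_nat => j /andP[lt_lj]; rewrite ltnS => le_jm.
    by rewrite /c' leqNgt lt_lj le_jm.
  by move=> j; rewrite andbT /c' /= ltnS => ->; rewrite scale0r.
exists c'; split; split.
- by rewrite lt_lm.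
- by rewrite lt_lp.
- by rewrite /c' leqNgt lt_lp le_pm.
- by move=> j; rewrite /c' => ->.
- by rewrite head.
- move=> k le_nk; have lt_mk := leq_trans lt_mn le_nk.
  rewrite (big_cat_nat _ (n := m.+1)) //=; last by rewrite ltnS ltnW.
  rewrite head c_cancel // -big_split /= big_nat_cond big1 // => j.
  rewrite andbT => /andP[lt_mj _].
  by rewrite /c' (ltn_geF (ltn_trans lt_lm lt_mj)) ltn_geF // scaleNr subrr.
Qed.

(** A nonzero target in [O] forces a nonzero coefficient, which provides the pivot. *)
Lemma block_exists (l : nat) (O : set X) :
    open [set~ (0 : X)] -> dense (T_set x l.+1) -> open O -> O !=set0 ->
  exists n m p c, block l O n m p c.
Proof.
move=> C0_open T_dense Oo [v Ov].
have [[w [Ow w_neq0]]|O_sub0] := pselect (exists w, O w /\ w <> 0).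
- have [|b [[Ob b_neq0] [n [m [lt_mn lt_lm [c [b_def c_cancel]]]]]]] :=
    T_dense (O `&` [set~ 0]) _ (openI Oo C0_open); first by exists w.
  have [p lp cp] : exists2 p, (l < p <= m)%N & c p != 0.
    apply: contrapT => c0; apply: b_neq0; rewrite b_def big_nat_cond big1 //.
    move=> j; rewrite andbT => lt_ljm.
    have [-> |cj] := eqVneq (c j) 0; first by rewrite scale0r.
    by case: c0; exists j.
  have [|c' c'P] := @block_of_T_set l n m p O c lt_mn lp cp _ c_cancel.
    by rewrite -b_def.
  by exists n, m, p, c'.
- (* {0} is open, so X is trivial and every scalar sequence yields a block. *)
  have O_eq0 w : O w -> w = 0.
    by move=> Ow; apply: contrapT => w_neq0; apply: O_sub0; exists w.
  have triv : forall w : X, w = 0.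
    apply: open_set1_trivial; rewrite -(_ : O = [set 0]) //.
    by apply/seteqP; split=> w /=; [exact: O_eq0|move->; rewrite -(O_eq0 v)].
  have [|//||c' c'P] :=
      @block_of_T_set l l.+2 l.+1 l.+1 O (fun=> 1) (ltnSn _) _ (oner_neq0 _).
  + by rewrite ltnSn.
  + by rewrite [X in O X]triv -(O_eq0 v).
  + by move=> k _; rewrite [LHS]triv [RHS]triv.
  + by exists l.+2, l.+1, l.+1, c'.
Qed.

Lemma block_sequence (O : nat -> set X) :
    open [set~ (0 : X)] ->
    (forall l, (1 <= l)%N -> dense (T_set x l)) ->
    (forall s, open (O s) /\ O s !=set0) ->
  exists (L m p : nat -> nat) (c : nat -> nat -> K),
    forall s, block (L s) (O s) (L s.+1) (m s) (p s) (c s).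
Proof.
move=> C0_open T_dense O_open.
have /choice[B BP] (ls : nat * nat) : exists b : nat * nat * nat * (nat -> K),
    block ls.1 (O ls.2) b.1.1.1 b.1.1.2 b.1.2 b.2.
  have [Oo O0] := O_open ls.2.
  have [n [m [p [c cP]]]] := block_exists C0_open (T_dense ls.1.+1 isT) Oo O0.
  by exists (n, m, p, c).
(* The next block starts at the index from which the current one has cancelled. *)
pose L := nat_rect (fun=> nat) 0%N (fun s l => (B (l, s)).1.1.1).
exists L, (fun s => (B (L s, s)).1.1.2), (fun s => (B (L s, s)).1.2),
  (fun s => (B (L s, s)).2).
by move=> s; exact: (BP (L s, s)).
Qed.

Section Block_sequence.
Variables (O : nat -> set X) (L m p : nat -> nat) (c : nat -> nat -> K).
Hypothesis cP : forall s, block (L s) (O s) (L s.+1) (m s) (p s) (c s).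

Lemma block_start_lt s t : (s < t)%N -> (L s.+1 <= L t)%N.
Proof.
have L_mono : {homo L : a b / (a <= b)%N}.
  apply: homo_leq => [//|b a d|i]; first exact: leq_trans.
  by have [[/andP[lt_Lm lt_mL] _ _] _] := cP i; apply/ltnW/(ltn_trans lt_Lm).
exact: L_mono.
Qed.

Lemma block_start_ge s : (s <= L s)%N.
Proof.
elim: s => // s IH; have [[/andP[lt_Lm lt_mL] _ _] _] := cP s.
by apply: leq_ltn_trans IH _; apply: ltn_trans lt_mL.
Qed.

(** Blocks [t < s] have cancelled by row [m s], as [L t.+1 <= L s < m s]; blocks [t > s] have not
    begun, as [m s < L s.+1 <= L t]. *)
Lemma comb_block_sum (beta : nat -> K) (s : nat) :
  \sum_(0 <= k < (m s).+1) comb c beta k *: x (m s) k =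
  beta s *: \sum_(0 <= k < (m s).+1) c s k *: x (m s) k.
Proof.
have [[/andP[lt_Lm lt_mL] _ _] _] := cP s.
have le_sm : (s <= m s)%N by apply: leq_trans (block_start_ge s) (ltnW lt_Lm).
(* A summation range independent of [k] allows the exchange of sums; the added terms vanish because
   [k < t <= L t]. *)
have comb_ext k : (k <= m s)%N ->
    comb c beta k = \sum_(0 <= t < (m s).+1) beta t * c t k.
  move=> le_km; rewrite [RHS](big_cat_nat _ (n := k.+1)) //=.
  rewrite -[LHS]addr0; congr (_ + _); rewrite big_nat_cond big1 // => t.
  rewrite andbT => /andP[lt_kt _]; have [_ [c0 _ _]] := cP t.
  by rewrite c0 ?mulr0 // (leq_trans (ltnW lt_kt)) // block_start_ge.
transitivity (\sum_(0 <= t < (m s).+1)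
    beta t *: \sum_(0 <= k < (m s).+1) c t k *: x (m s) k).
  under [RHS]eq_bigr => t _ do rewrite scaler_sumr.
  rewrite [RHS]exchange_big; apply: eq_big_nat => k /andP[_ le_km].
  rewrite comb_ext // scaler_suml; apply: eq_bigr => t _.
  by rewrite scalerA.
rewrite (big_cat_nat _ (n := s)) ?leqW //= big_nat_cond big1 ?add0r; last first.
  move=> t; rewrite andbT => lt_ts; have [_ [_ _ c_cancel]] := cP t.
  by rewrite c_cancel ?scaler0 // (leq_trans (block_start_lt lt_ts)) // ltnW.
rewrite big_nat_recl //= -[RHS]addr0; congr (_ + _).
rewrite big_nat_cond big1 // => t; rewrite andbT => /andP[lt_st _].
rewrite big_nat_cond big1 ?scaler0 // => k; rewrite andbT ltnS => le_km.
have [_ [c0 _ _]] := cP t.+1; rewrite c0 ?scale0r //.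
by rewrite (leq_trans le_km) // (leq_trans (ltnW lt_mL)) // block_start_lt.
Qed.

Lemma block_coef : exists f : nat -> (nat -> K^o) -> K^o,
  (forall s, continuous (f s : {ptws nat -> K^o} -> K^o)) /\
  (forall s beta, f s (comb c beta) = beta s).
Proof.
apply: (@comb_coef K c p) => [s|s t lt_st|s];
  have [[_ /andP[lt_Lp le_pm] cp] _] := cP s.
- by [].
- have [_ [c0 _ _]] := cP t; apply: c0.
  have [[/andP[_ lt_mL] _ _] _] := cP s.
  by rewrite (leq_trans le_pm) // (leq_trans (ltnW lt_mL)) // block_start_lt.
- by rewrite (leq_trans (block_start_ge s)) // ltnW.
Qed.

End Block_sequence.
End Blocks.

(** * The closed infinite-dimensional subspace *)

Section Span.
Variables (K : numFieldType) (c : nat -> nat -> K).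
Variable f : nat -> (nat -> K^o) -> K^o.
Hypothesis f_cont : forall s, continuous (f s : {ptws nat -> K^o} -> K^o).
Hypothesis f_comb : forall s beta, f s (comb c beta) = beta s.
Variables (i sigma : nat -> nat).
Hypothesis sigmaK : cancel sigma i.

(** The coefficient of block [s] depends only on its label [i s], so a single [alpha j] serves all
    blocks labelled [j]; [sigma j] is one of them. *)
Definition combs : set (nat -> K^o) :=
  [set a | exists alpha : nat -> K, a = comb c (alpha \o i)].

Lemma combs_submod : GRing.submod_closed [in combs].
Proof.
split.
  apply/mem_set; exists (fun=> 0); apply/funext => k.
  by rewrite /comb big1 // => s _; rewrite mul0r.
move=> r a b /set_mem[alpha ->] /set_mem[alpha' ->]; apply/mem_set.
by exists (fun t => r * alpha t + alpha' t); rewrite -comb_linear.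
Qed.

(** The only candidate for [alpha t] is [f (sigma t) a], so membership amounts to the continuous
    equations [g k a = 0]. *)
Lemma combs_closed : closed (combs : set {ptws nat -> K^o}).
Proof.
pose g k (a : {ptws nat -> K^o}) : K^o :=
  a k - comb c (fun s => f (sigma (i s)) a) k.
have -> : combs = \bigcap_(k in setT) (g k @^-1` [set 0]).
  apply/seteqP; split=> [a [alpha ->] k _ | a a0].
    rewrite /g /= -[X in _ - comb c X k](_ : alpha \o i = _) ?subrr //.
    by apply/funext => s; rewrite f_comb /= sigmaK.
  exists (fun t => f (sigma t) a); apply/funext => k.
  by apply/eqP; rewrite -subr_eq0; apply/eqP; exact: (a0 k I).
apply: closed_bigI => k _; apply: preimage_closed.
  move=> a _; apply: (@cvgB _ _ _ (nbhs (a : {ptws nat -> K^o}))).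
    exact: (@proj_continuous nat (fun=> K^o) k a).
  move: a; apply: (@continuous_big K^o) => [|s _ a].
    exact: (@tvs.add_continuous K^o).
  by apply: (@cvgM K _ (nbhs (a : {ptws nat -> K^o})));
    [exact: f_cont|exact: cvg_cst].
exact/accessible_closed_set1/hausdorff_accessible/norm_hausdorff.
Qed.

(** The combinations for the unit vectors [alpha] are independent: reading the coefficient of block
    [sigma j] isolates [a j]. *)
Lemma combs_infinite : ~ finite_dimensional combs.
Proof.
apply: (@not_finite_dimensional K _ _
  (fun j => comb c ((fun t => (t == j)%:R) \o i))) => [j|n a].
  by exists (fun t => (t == j)%:R).
rewrite comb_sum => a0 j; have := f_comb (sigma j).
move/(_ (fun=> 0)); have -> : comb c (fun=> 0) = 0.
  by apply/funext => k; rewrite /comb big1 // => s _; rewrite mul0r.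
rewrite -a0 f_comb (bigD1 j) //= sigmaK eqxx mulr1 big1 ?addr0 // => k k_j.
by rewrite eq_sym (inj_eq val_inj) (negbTE k_j) mulr0.
Qed.

End Span.

(** * Universality of the nonzero combinations *)

Lemma metrizable_openC1 (R : realType) (T : topologicalType) (a : T) :
  metrizable R T -> open [set~ a].
Proof.
move=> [rho [rho_ge0 rho0 rhoC rho_tri rho_nbhs]].
rewrite openE => y ya; apply/rho_nbhs; exists (rho y a).
  by rewrite lt_neqAle rho_ge0 eq_sym andbT; apply/eqP => /rho0.
by move=> z /= /[swap] ->; rewrite ltxx.
Qed.

Lemma separable_spaceable (R : realType) (K : numFieldType) (q : nat -> K)
    (q_dense : forall z e : K, 0 < e -> exists n, `|z - q n| < e)
    (X : topologicalLmodType K) (X_metrizable : metrizable R X)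
    (x : nat -> nat -> X)
    (T_dense : forall l : nat, (1 <= l)%N -> dense (T_set x l)) :
  spaceable (universal_sequences x).
Proof.
pose dec t : nat * seq nat := odflt (0%N, [::]) (unpickle t).
(* A countable dense family: elements of [T_set x 1] are sums over [1 <= j <= m], hence the shift
   [j.+1], and their scalars are approximated by values of [q]. *)
pose d t := \sum_(0 <= j < size (dec t).2)
  q (nth 0%N (dec t).2 j) *: x (dec t).1 j.+1.
have d_dense : dense (range d).
  move=> U U0 Uo; have [b [Ub [n [m [_ _ [a [b_def _]]]]]]] :=
    T_dense 1%N isT U U0 Uo.
  rewrite {}b_def big_add1 /= -[X in U X]add0r in Ub.
  have [s size_s Us] :=
    dense_combination q_dense (y := fun j => x m j.+1)
      (c := fun j => a j.+1) Uo Ub.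
  exists (d (pickle (m, s))); split; last by exists (pickle (m, s)).
  by rewrite /d /dec pickleK /= size_s -[X in U X]add0r.
have [B [B_open B_base]] := metrizable_pseudobase X_metrizable d_dense.
pose pr s : nat * nat := odflt (0, 0)%N (unpickle s).
have prK : cancel pickle pr by move=> it; rewrite /pr pickleK.
have [L [m [p [c cP]]]] := block_sequence (metrizable_openC1 0 X_metrizable)
  T_dense (fun s => B_open (pr s).2).
have [f [f_cont f_comb]] := block_coef cP.
pose sigma (j : nat) : nat := pickle (j, 0%N).
have sigmaK : cancel sigma (fun s => (pr s).1) by move=> j; rewrite /sigma prK.
exists (combs c (fun s => (pr s).1)); split.
- exact: combs_submod.
- exact: (@combs_closed K c f f_cont f_comb _ sigma sigmaK).
- exact: (@combs_infinite K c f f_comb _ sigma sigmaK).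
move=> _ [[alpha ->] a_neq0] U [v Uv] Uo.
have [j alpha_j] : exists j, alpha j != 0.
  apply: contrapT => alpha0; apply: a_neq0; apply/funext => k.
  rewrite /comb big1 // => s _ /=.
  have [-> |?] := eqVneq (alpha (pr s).1) 0; first by rewrite mul0r.
  by case: alpha0; exists (pr s).1.
(* Block (j, t) will be multiplied by [alpha j], so its target must lie in the preimage of [U] under
   this scaling. *)
have [|t BtU] := B_base _ (scale_open alpha_j Uo).
  by exists ((alpha j)^-1 *: v); rewrite /= scalerA divff ?scale1r.
pose s : nat := pickle (j, t).
exists (\sum_(0 <= k < (m s).+1)
  comb c (alpha \o (fun s => (pr s).1)) k *: x (m s) k).
split; last by exists (m s).
rewrite (comb_block_sum cP) /= prK; apply: BtU.
by have [_ [_ Bs _]] := cP s; rewrite prK in Bs.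
Qed.

(** * Separability of the real and complex scalars *)

Lemma realType_dense_sequence (R : realType) :
  exists q : nat -> R, forall z e : R, 0 < e -> exists n, `|z - q n| < e.
Proof.
exists (fun n => ratr (odflt 0 (unpickle n))) => z e e_gt0.
have [r] : exists r : rat, ratr r \in `]z - e, z + e[.
  by apply: rat_in_itvoo; rewrite ltrD2l gtrN.
rewrite in_itv /= => /andP[lt_r gt_r]; exists (pickle r).
by rewrite pickleK /= distrC ltr_distl lt_r.
Qed.

Lemma complex_dense_sequence (R : realType) :
  exists q : nat -> R[i], forall z e : R[i], 0 < e -> exists n, `|z - q n| < e.
Proof.
have [q q_dense] := realType_dense_sequence R.
pose dec n : nat * nat := odflt (0, 0)%N (unpickle n).
exists (fun n => (q (dec n).1 +i* q (dec n).2)%C) => -[a b] [e e'].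
(* In the order of [R[i]], a positive [e] has imaginary part 0. *)
rewrite ltcE /= => /andP[/eqP -> e_gt0].
have e2_gt0 : 0 < e / 2 by rewrite divr_gt0.
have [[r ar] [s bs]] := (q_dense a _ e2_gt0, q_dense b _ e2_gt0).
exists (pickle (r, s)); rewrite /dec pickleK /=.
rewrite -[(e +i* 0)%C]/(e%:C)%C normc_def ltcR /=.
rewrite -[ltRHS]ger0_norm ?(ltW e_gt0) //.
rewrite -sqrtr_sqr ltr_sqrt ?exprn_gt0 // -(real_normK (num_real (a - _))).
rewrite -(real_normK (num_real (b - _))).
(* The two squares add up to less than [e ^+ 2 / 2]. *)
have: `|a - q r| ^+ 2 < (e / 2) ^+ 2 by rewrite ltr_pXn2r ?nnegrE // ltW.
have: `|b - q s| ^+ 2 < (e / 2) ^+ 2 by rewrite ltr_pXn2r ?nnegrE // ltW.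
have : 0 < e ^+ 2 by rewrite exprn_gt0.
by rewrite expr_div_n; lra.
Qed.

Theorem proposition2p17 (R : realType) (K : numFieldType)
    (K_R_or_C : K = (R : numFieldType) \/ K = (R[i] : numFieldType))
    (X : topologicalLmodType K) (X_metrizable : metrizable R X)
    (x : nat -> nat -> X)
    (x_cvg : forall k : nat, exists y : X, x n k @[n --> \oo] --> y)
    (T_dense : forall l : nat, (1 <= l)%N -> dense (T_set x l)) :
  spaceable (universal_sequences x).
Proof.
have [q q_dense] : exists q : nat -> K, forall z e : K, 0 < e ->
    exists n, `|z - q n| < e.
  by case: K_R_or_C => ->; [exact: realType_dense_sequence
                           |exact: complex_dense_sequence].
exact: separable_spaceable q_dense _ X_metrizable _ T_dense.
Qed.
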